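(* Let $p$ be a prime, let $n$ be a positive integer such that $p\mid n$, and set $\ell=2\,\mathrm{ord}_p(n)$. Let $A$ be the $n\times n$ matrix over $\mathbb{Q}_p$ all of whose entries are equal to $1$ except the upper-left entry, which is equal to $1+p^\ell$ (so all entries of $A$ are elements of the disc $D(1,p^{-\ell})$). Then $A$ has no strictly maximal eigenvalue; that is, there is no eigenvalue $\lambda_0\in\mathbb{C}_p$ of $A$ such that $|\lambda|_p<|\lambda_0|_p$ for all other eigenvalues $\lambda\in\mathbb{C}_p$ of $A$.
   Context: $|\cdot|_p$ is the $p$-adic absolute value, normalized so that $|p|_p=1/p$, and $\mathrm{ord}_p$ is the corresponding valuation with $\mathrm{ord}_p(p)=1$. $\mathbb{C}_p$ is the completion of the algebraic closure of $\mathbb{Q}_p$, with $|\cdot|_p$ extended to it. For $c\in\mathbb{Q}_p$ and real $r>0$, $D(c,r)=\{x\in\mathbb{Q}_p : |x-c|_p\leq r\}$. *)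

(* Defs.v *)
From HB Require Import structures.
From mathcomp Require Import all_boot all_order all_algebra.
From mathcomp Require Import classical_sets reals.

Set Implicit Arguments.
Unset Strict Implicit.
Unset Printing Implicit Defensive.

Import Order.TTheory GRing.Theory Num.Theory.
Local Open Scope classical_set_scope.
Local Open Scope ring_scope.

Record nonarch_abs (R : realType) (K : fieldType) (v : K -> R) : Prop :=
  NonarchAbs {
    nonarch_abs_ge0 : forall x, 0 <= v x ;
    nonarch_abs_eq0 : forall x, v x = 0 <-> x = 0 ;
    nonarch_absM : forall x y, v (x * y) = v x * v y ;
    nonarch_absD : forall x y, v (x + y) <= Num.max (v x) (v y) }.

Definition abs_cauchy (R : realType) (K : fieldType) (v : K -> R)
    (u : nat -> K) : Prop :=
  forall e : R, 0 < e ->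
    exists N : nat, forall i j : nat,
      (N <= i)%N -> (N <= j)%N -> v (u i - u j) < e.

Definition abs_cvg (R : realType) (K : fieldType) (v : K -> R)
    (u : nat -> K) (l : K) : Prop :=
  forall e : R, 0 < e ->
    exists N : nat, forall i : nat, (N <= i)%N -> v (u i - l) < e.

(* (L, w) is a completion of (K, v) along f. *)
Record is_completion (R : realType) (K L : fieldType) (v : K -> R)
    (w : L -> R) (f : {rmorphism K -> L}) : Prop := IsCompletion {
  completion_abs : nonarch_abs w ;
  completion_isometry : forall x, w (f x) = v x ;
  completion_dense : forall (y : L) (e : R), 0 < e ->
    exists x : K, w (y - f x) < e ;
  completion_complete : forall u : nat -> L, abs_cauchy w u ->
    exists l : L, abs_cvg w u l }.

(* The p-adic absolute value on rat. Since numq x and denq x are coprime, at  *)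
(* most one of the two exponents is nonzero when p is prime.                  *)
Definition padic_abs_rat (R : realType) (p : nat) (x : rat) : R :=
  if x == 0 then 0
  else p%:R ^+ logn p `|denq x|%N / p%:R ^+ logn p `|numq x|%N.

(* The field Q_p, given by the property defining it up to a unique isometric  *)
(* isomorphism: it is a completion of rat for the p-adic absolute value.      *)
Record padicField (R : realType) (p : nat) := PadicField {
  padic_sort :> fieldType ;
  padic_abs : padic_sort -> R ;
  padic_of_rat : {rmorphism rat -> padic_sort} ;
  padic_completion :
    is_completion (@padic_abs_rat R p) padic_abs padic_of_rat }.

(* The field C_p over Q_p: an algebraic closure of Q_p, an absolute value on  *)
(* it extending that of Q_p, and a completion of the result. These data are   *)
(* determined up to an isometric isomorphism over Q_p.                        *)
Record padicComplex (R : realType) (p : nat) (Qp : padicField R p) :=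
  PadicComplex {
    algclosure_sort : closedFieldType ;
    algclosure_abs : algclosure_sort -> R ;
    algclosure_of_padic : {rmorphism Qp -> algclosure_sort} ;
    algclosure_algebraic : forall x, algebraicOver algclosure_of_padic x ;
    algclosure_nonarch : nonarch_abs algclosure_abs ;
    algclosure_isometry :
      forall x, algclosure_abs (algclosure_of_padic x) = padic_abs x ;
    Cpadic_sort :> fieldType ;
    Cpadic_abs : Cpadic_sort -> R ;
    Cpadic_of_algclosure : {rmorphism algclosure_sort -> Cpadic_sort} ;
    Cpadic_completion :
      is_completion algclosure_abs Cpadic_abs Cpadic_of_algclosure }.

Definition Cpadic_of_padic (R : realType) (p : nat) (Qp : padicField R p)
    (Cp : padicComplex Qp) : {rmorphism Qp -> Cp} :=
  @Cpadic_of_algclosure R p Qp Cp \o @algclosure_of_padic R p Qp Cp.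

Definition padic_disc (R : realType) (p : nat) (Qp : padicField R p)
    (c : Qp) (r : R) : set Qp :=
  [set x | padic_abs (x - c) <= r].

Definition perturbed_ones (K : fieldType) (n : nat) (d : K) : 'M[K]_n :=
  \matrix_(i < n, j < n)
    if ((i : nat) == 0%N) && ((j : nat) == 0%N) then 1 + d else 1.

(* Eigenvalues are counted without multiplicity: the "other" eigenvalues are  *)
(* those different from a0.                                                   *)
Definition strictly_maximal_eigenvalue (R : realType) (K : fieldType)
    (v : K -> R) (n : nat) (A : 'M[K]_n) (a0 : K) : Prop :=
  eigenvalue A a0 /\ forall a : K, eigenvalue A a -> a != a0 -> v a < v a0.

(* Main.v *)
Require Import Defs.
From mathcomp Require Import all_boot all_order all_algebra.
From mathcomp Require Import classical_sets reals.
From mathcomp Require Import ring.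

Set Implicit Arguments.
Unset Strict Implicit.
Unset Printing Implicit Defensive.

Import Order.TTheory GRing.Theory Num.Theory.
Local Open Scope ring_scope.

(** Write d = p^l and k = ord_p(n), so l = 2k. The nonzero eigenvalues of A are
    the roots of X^2 - (n + d) X + (n - 1) d, whose discriminant is
    (n - d)^2 + 4 d > 0, so there are two of them. Since |n + d| <= p^-k and
    |(n - 1) d| = p^-2k, a root a0 strictly larger than the other root a1 would
    satisfy |a0| <= |a0 + a1| <= p^-k on the one hand, and
    |a0|^2 > |a0 a1| = p^-2k on the other. *)

(** The matrix is the all-ones matrix plus [d] times the elementary matrix at the upper-left
    corner. *)
Lemma mulmx_perturbed_ones (K : fieldType) m (d : K) (u : 'rV[K]_m.+1) j :
  (u *m perturbed_ones m.+1 d) 0 j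
  = \sum_i u 0 i + (if j == 0 then d * u 0 0 else 0).
Proof.
rewrite mxE (bigD1 ord0) //= [in RHS](bigD1 ord0) //= !mxE /=.
rewrite (eq_bigr (fun i => u 0 i)); last first.
  move=> i i0; rewrite mxE -(inj_eq val_inj) /= in i0 *.
  by rewrite (negPf i0) mulr1.
by rewrite -(inj_eq val_inj) /=; case: ifP => _; ring.
Qed.

Lemma map_perturbed_ones (K L : fieldType) (f : {rmorphism K -> L}) n d :
  map_mx f (perturbed_ones n d) = perturbed_ones n (f d).
Proof.
by apply/matrixP => i j; rewrite !mxE; case: ifP; rewrite ?rmorphD rmorph1.
Qed.

(** For [a != 0], an eigenvector with coordinate sum [S] has every coordinate but the first equal to
    [S / a]. Only two unknowns remain, and the quadratic is their compatibility condition. *)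
Lemma eigenvalue_perturbed_ones (K : fieldType) m (d a : K) : a != 0 ->
  eigenvalue (perturbed_ones m.+1 d) a
  = (a ^+ 2 - (m.+1%:R + d) * a + m%:R * d == 0).
Proof.
move=> a0; apply/eigenvalueP/eqP => [[u uA u0]|qa].
- have E j := congr1 (fun w : 'rV_m.+1 => w 0 j) uA.
  set S := \sum_i u 0 i in E.
  have E0 : S + d * u 0 0 = a * u 0 0.
    by move: (E 0); rewrite mulmx_perturbed_ones eqxx mxE.
  have Ej j : j != 0 -> S = a * u 0 j.
    by move=> j0; move: (E j); rewrite mulmx_perturbed_ones (negPf j0) mxE addr0.
  have ES : S = (a - d) * u 0 0 by rewrite mulrBl -E0 addrK.
  (* If [u 0 0] vanished, so would [S] by [ES], and then every other coordinate by [Ej]. *)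
  have u00 : u 0 0 != 0.
    apply: contraNneq u0 => u00; apply/eqP/rowP => j; rewrite mxE.
    have [->//|/Ej] := eqVneq j 0.
    rewrite ES u00 mulr0 => /esym/eqP.
    by rewrite mulf_eq0 (negPf a0) => /eqP.
  have sumE : a * S = a * u 0 0 + m%:R * S.
    rewrite {1}/S mulr_sumr big_ord_recl; congr (_ + _).
    rewrite (eq_bigr (fun=> S)) => [|i _]; last by rewrite -Ej.
    by rewrite sumr_const card_ord mulr_natl.
  apply: (mulIf u00); rewrite mul0r.
  apply: etrans (_ : a * S - (a * u 0 0 + m%:R * S) = 0); last first.
    by rewrite sumE subrr.
  by rewrite ES -natr1; ring.
(* Normalizing the first coordinate to [a] gives [S = (a - d) * a], so the other coordinates are
   [S / a = a - d]. *)
- exists (\row_j if j == 0 then a else a - d); last first.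
    by apply: contra_neq a0 => /rowP/(_ 0); rewrite !mxE eqxx.
  apply/rowP => j; rewrite mulmx_perturbed_ones big_ord_recl !mxE eqxx.
  rewrite (eq_bigr (fun=> a - d)) => [|i _]; last by rewrite mxE.
  rewrite sumr_const card_ord -mulr_natl.
  apply/eqP; rewrite -subr_eq0; apply/eqP.
  move: qa; rewrite -natr1; case: ifP => _ qa; rewrite -[RHS]oppr0 -[in RHS]qa; ring.
Qed.

Lemma closed_field_monic_quadratic (F : closedFieldType) (s q : F) :
  exists x, x ^+ 2 - s * x + q = 0.
Proof.
have [x xE] := @solve_monicpoly F 2 (nth 0 [:: - q; s]) isT.
by exists x; rewrite xE !big_ord_recl big_ord0 /=; ring.
Qed.

Lemma padic_abs_rat_nat (R : realType) p m : (0 < m)%N ->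
  padic_abs_rat R p m%:R = p%:R ^- logn p m.
Proof.
rewrite lt0n => m0; rewrite /padic_abs_rat pnatr_eq0 (negPf m0).
by rewrite -[m%:R]/((Posz m)%:~R) numq_int denq_int /= logn1 expr0 div1r.
Qed.

Section PadicComplex.
Variables (R : realType) (p : nat) (Qp : padicField R p).
Variable Cp : padicComplex Qp.

Lemma padic_abs_nat m : (0 < m)%N ->
  @padic_abs R p Qp m%:R = p%:R ^- logn p m.
Proof.
move=> m0; rewrite -(padic_abs_rat_nat R p m0).
by rewrite -(completion_isometry (padic_completion Qp)) rmorph_nat.
Qed.

Lemma Cpadic_abs_of_padic x :
  @Cpadic_abs R p Qp Cp (Cpadic_of_padic Cp x) = padic_abs x.
Proof.
by rewrite (completion_isometry (Cpadic_completion Cp)) algclosure_isometry.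
Qed.

Lemma Cpadic_abs_nat m : (0 < m)%N ->
  @Cpadic_abs R p Qp Cp m%:R = p%:R ^- logn p m.
Proof.
move=> m0; rewrite -(padic_abs_nat m0) -Cpadic_abs_of_padic.
by rewrite rmorph_nat.
Qed.

Lemma Cpadic_natr_eq0 m : (m%:R == 0 :> Cp) = (m == 0)%N.
Proof.
rewrite -(rmorph_nat (Cpadic_of_padic Cp)) fmorph_eq0.
by rewrite -(rmorph_nat (@padic_of_rat R p Qp)) fmorph_eq0 pnatr_eq0.
Qed.

(** [Cp] is only given as a field, so the root is found in the algebraic closure of [Qp] and
    transported; this works because the coefficients are natural numbers. *)
Lemma Cpadic_quadratic_natr s q :
  exists x : Cp, x ^+ 2 - s%:R * x + q%:R = 0.
Proof.
have [x xE] :=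
  closed_field_monic_quadratic (s%:R : algclosure_sort Cp) q%:R.
exists (Cpadic_of_algclosure Cp x).
have := congr1 (Cpadic_of_algclosure Cp) xE.
by rewrite rmorphD rmorphB rmorphXn rmorphM !rmorph_nat rmorph0.
Qed.

End PadicComplex.

Theorem mainTheorem3 (R : realType) (p : nat) (Qp : padicField R p)
    (Cp : padicComplex Qp) (n : nat) (p_prime : prime p) (n_gt0 : (0 < n)%N)
    (p_dvd_n : (p %| n)%N) :
  let l := (2 * logn p n)%N in
  let A : 'M[Qp]_n := perturbed_ones n (p%:R ^+ l) in
  (forall i j : 'I_n, padic_disc 1 (p%:R ^- l) (A i j)) /\
  ~ (exists a0 : Cp,
       strictly_maximal_eigenvalue (@Cpadic_abs R p Qp Cp)
         (map_mx (Cpadic_of_padic Cp) A) a0).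
Proof.
move=> l A; have p_gt0 := prime_gt0 p_prime.
have pl_gt0 : (0 < p ^ l)%N by rewrite expn_gt0 p_gt0.
have pR_gt0 : 0 < p%:R :> R by rewrite ltr0n.
split=> [i j|].
  rewrite /padic_disc /= mxE; case: ifP => _.
    rewrite addrC addKr -natrX padic_abs_nat // pfactorK //.
  rewrite subrr (nonarch_abs_eq0 (completion_abs (padic_completion Qp)) 0).2 //.
  by rewrite invr_ge0 exprn_ge0 // ltW.
move=> [a0 []]; rewrite /A map_perturbed_ones rmorphXn rmorph_nat -natrX.
(* From here on [n = m.+1], so [m] stands for n - 1. *)
case: n n_gt0 p_dvd_n @l @A pl_gt0 => // m _ p_dvd_m1 l _.
set d := (p ^ l)%N => d_gt0.
set v := @Cpadic_abs R p Qp Cp.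
have [v_ge0 v_eq0 vM vD] := completion_abs (Cpadic_completion Cp).
rewrite -/v in v_ge0 v_eq0 vM vD.
set k := logn p m.+1 in l d d_gt0 *.
have m_gt0 : (0 < m)%N.
  case: m p_dvd_m1 {k l d d_gt0} => //; rewrite dvdn1 => /eqP p1.
  by rewrite p1 in p_prime.
(* [p] divides [m.+1], so it cannot divide [m]; hence [m] has absolute value 1 in [vq]. *)
have pNm : ~~ (p %| m)%N.
  apply/negP => pm; move: p_dvd_m1; rewrite -addn1 dvdn_addr // dvdn1 => /eqP p1.
  by rewrite p1 in p_prime.
have vN x : v (- x) = v x.
  have v1 : v 1 = 1 by rewrite -[1]/(1%:R) /v Cpadic_abs_nat // logn1 expr0 invr1.
  have : v (-1) ^+ 2 = 1 by rewrite expr2 -vM mulrNN mulr1.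
  move/eqP; rewrite sqrp_eq1 // => /eqP vN1.
  by rewrite -mulN1r vM vN1 mul1r.
pose r : R := p%:R ^- k.
have r_gt0 : 0 < r by rewrite invr_gt0 exprn_gt0.
have r_le1 : r <= 1.
  by rewrite invf_le1 ?exprn_gt0 // exprn_ege1 // ler1n.
have vd : v d%:R = r ^+ 2.
  by rewrite /v Cpadic_abs_nat // pfactorK // /l mulnC exprM exprVn.
have vs : v (m.+1%:R + d%:R) <= r.
  apply: le_trans (vD _ _) _; rewrite ge_max vd /v Cpadic_abs_nat // lexx /=.
  by rewrite expr2 ler_piMl // ltW.
have vq : v (m%:R * d%:R) = r ^+ 2.
  rewrite vM vd /v Cpadic_abs_nat //.
  have -> : logn p m = 0%N
    by apply/eqP; rewrite -leqn0 leqNgt logn_gt0 mem_primes p_prime m_gt0.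
  by rewrite expr0 invr1 mul1r.
have q_neq0 : m%:R * d%:R != 0 :> Cp.
  by rewrite -natrM Cpadic_natr_eq0 -lt0n muln_gt0 m_gt0.
have root_neq0 (a : Cp) : a ^+ 2 - (m.+1%:R + d%:R) * a + m%:R * d%:R = 0 -> a != 0.
  by apply: contra_eq_neq => ->; rewrite expr0n mulr0 subr0 add0r.
move=> ev0 max0.
(* Zero cannot be strictly maximal: the quadratic has a nonzero root, whose absolute value would
   have to be negative. *)
have [a0_eq0|a0_neq0] := eqVneq a0 0.
  have [a] := Cpadic_quadratic_natr Cp (m.+1 + d) (m * d).
  rewrite natrD natrM => qa; have a_neq0 := root_neq0 _ qa.
  have := max0 a; rewrite eigenvalue_perturbed_ones // qa eqxx a0_eq0.
  move=> /(_ isT a_neq0); rewrite (v_eq0 0).2 //.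
  by rewrite ltNge v_ge0.
move: ev0; rewrite eigenvalue_perturbed_ones // => /eqP q0.
(* By Vieta, this is the second root of the quadratic. *)
pose a1 := m.+1%:R + d%:R - a0.
have a01 : a0 * a1 = m%:R * d%:R.
  by apply/eqP; rewrite eq_sym -subr_eq0 -q0 /a1; apply/eqP; ring.
have q1 : a1 ^+ 2 - (m.+1%:R + d%:R) * a1 + m%:R * d%:R = 0.
  by rewrite -q0 /a1; ring.
have a1_neq_a0 : a1 != a0.
  (* A double root would make the discriminant vanish in [Cp], hence among the natural numbers by
     characteristic zero. But 4 m d is at most (m + d)^2 by AM-GM, hence less than (m + 1 + d)^2. *)
  apply/eqP => a1E.
  have disc : ((m.+1 + d) ^ 2)%:R = (4 * (m * d))%:R :> Cp.
    rewrite natrX natrD !natrM -a01 a1E.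
    have -> : m.+1%:R + d%:R = a0 + a0 :> Cp by rewrite -{1}a1E /a1 subrK.
    by ring.
  have lt_disc : (4 * (m * d) < (m.+1 + d) ^ 2)%N.
    apply: leq_ltn_trans (_ : (m + d) ^ 2 < _)%N; last by rewrite ltn_exp2r.
    by have := nat_AGM2 m d; case.
  have : (((m.+1 + d) ^ 2 - 4 * (m * d))%N)%:R == 0 :> Cp.
    by rewrite natrB 1?ltnW // disc subrr.
  by rewrite Cpadic_natr_eq0 subn_eq0 leqNgt lt_disc.
have v10 : v a1 < v a0.
  by apply: max0 => //; rewrite eigenvalue_perturbed_ones ?root_neq0 // q1.
(* Apply the ultrametric inequality to [a0] as the sum of the roots minus [a1]; [v10] rules out [a1]
   as the term bounding [v a0]. *)
have v0_le : v a0 <= r.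
  have := vD (m.+1%:R + d%:R) (- a1).
  rewrite vN /a1 opprB addrC subrK -/a1 le_max [_ <= v a1]leNgt v10 orbF.
  by move=> /le_trans; apply.
have : v a0 * v a1 < r ^+ 2.
  have v0_gt0 : 0 < v a0 by apply: le_lt_trans v10.
  apply: lt_le_trans (_ : v a0 * v a0 <= _); first by rewrite ltr_pM2l.
  by rewrite expr2 ler_pM.
by rewrite -vM a01 vq ltxx.
Qed.
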